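(* Let $\lambda,\mu>0$ and let $\{N(t);t\ge 0\}$ be the birth-death process on $\mathbb{Z}$ with transition rates $\lambda$ from each even state to each of its two neighbours and $\mu$ from each odd state to each of its two neighbours, with transition probabilities $p_{k,n}(t)=P\{N(t)=n\mid N(0)=k\}$. Then for all $l,r\in\mathbb{Z}$ and $t\ge 0$: $$p_{2l,2r}(t)=e^{-(\lambda+\mu)t}\sum_{n=|r-l|}^{+\infty}\left[\frac{(\lambda t)^{2n}}{(2n)!}+\left(\frac{\mu-\lambda}{\lambda}\right)\frac{(\lambda t)^{2n+1}}{(2n+1)!}\right]\sum_{k=0}^{n-|r-l|}\binom{n}{k}\binom{n}{k+|r-l|}\left(\frac{\lambda}{\mu}\right)^{-2k-|r-l|},$$ $$p_{2l,2r+1}(t)=e^{-(\lambda+\mu)t}\left\{\sum_{n=|r-l|}^{+\infty}\frac{(\lambda t)^{2n+1}}{(2n+1)!}\sum_{k=0}^{n-|r-l|}\binom{n}{k}\binom{n}{k+|r-l|}\left(\frac{\lambda}{\mu}\right)^{-2k-|r-l|}+\sum_{n=|r-l+1|}^{+\infty}\frac{(\lambda t)^{2n+1}}{(2n+1)!}\sum_{k=0}^{n-|r-l+1|}\binom{n}{k}\binom{n}{k+|r-l+1|}\left(\frac{\lambda}{\mu}\right)^{-2k-|r-l+1|}\right\},$$ $$p_{2l+1,2r}(t)=e^{-(\lambda+\mu)t}\left\{\sum_{n=|r-l-1|}^{+\infty}\frac{(\mu t)^{2n+1}}{(2n+1)!}\sum_{k=0}^{n-|r-l-1|}\binom{n}{k}\binom{n}{k+|r-l-1|}\left(\frac{\mu}{\lambda}\right)^{-2k-|r-l-1|}+\sum_{n=|r-l|}^{+\infty}\frac{(\mu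 t)^{2n+1}}{(2n+1)!}\sum_{k=0}^{n-|r-l|}\binom{n}{k}\binom{n}{k+|r-l|}\left(\frac{\mu}{\lambda}\right)^{-2k-|r-l|}\right\},$$ $$p_{2l+1,2r+1}(t)=e^{-(\lambda+\mu)t}\sum_{n=|r-l|}^{+\infty}\left[\frac{(\mu t)^{2n}}{(2n)!}+\left(\frac{\lambda-\mu}{\mu}\right)\frac{(\mu t)^{2n+1}}{(2n+1)!}\right]\sum_{k=0}^{n-|r-l|}\binom{n}{k}\binom{n}{k+|r-l|}\left(\frac{\mu}{\lambda}\right)^{-2k-|r-l|}.$$
   Context: $\{N(t);t\ge0\}$ is the time-homogeneous continuous-time Markov chain on $\mathbb{Z}$ whose only allowed transitions are to nearest neighbours, with rates $\nu_{2n,2n\pm1}=\lambda$ and $\nu_{2n\pm1,2n}=\mu$ for all $n\in\mathbb{Z}$, where $\nu_{j,n}=\lim_{h\to0}\frac1h P\{N(t+h)=n\mid N(t)=j\}$ for $j\neq n$. Equivalently, for each initial state $k\in\mathbb{Z}$, the transition probabilities satisfy, for all $t\ge0$ and $n\in\mathbb{Z}$, $$\frac{d}{dt}p_{k,2n}(t)=\mu p_{k,2n-1}(t)-2\lambda p_{k,2n}(t)+\mu p_{k,2n+1}(t),\qquad \frac{d}{dt}p_{k,2n+1}(t)=\lambda p_{k,2n}(t)-2\mu p_{k,2n+1}(t)+\lambda p_{k,2n+2}(t),$$ with $p_{k,n}(0)=\delta_{n,k}$ (Kronecker delta). *)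

(* Defs.v *)
From HB Require Import structures.
From mathcomp Require Import all_boot all_order all_algebra.
From mathcomp Require Import all_classical all_reals all_analysis.

Set Implicit Arguments.
Unset Strict Implicit.
Unset Printing Implicit Defensive.

Import Order.TTheory GRing.Theory Num.Theory.
Import numFieldNormedType.Exports.

Local Open Scope classical_set_scope.
Local Open Scope ring_scope.

(* Meaningful only when [P B] is nonzero: division by zero yields zero. *)
Definition cond_prob d (Omega : measurableType d) (R : realType)
    (P : probability Omega R) (A B : set Omega) : R :=
  fine (P (A `&` B)) / fine (P B).

Definition state_at (R : realType) (Omega : Type) (N : R -> Omega -> int)
    (t : R) (n : int) : set Omega := [set w | N t w = n].

(* The event that the process is in state x.2 at time x.1, for all x in s. *)
Definition history (R : realType) (Omega : Type) (N : R -> Omega -> int)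
    (s : seq (R * int)) : set Omega :=
  [set w | forall x, x \in s -> N x.1 w = x.2].

(* N, observed at nonnegative times, is a time-homogeneous continuous-time
   Markov chain on the integers, and P{N(t+h) = n | N(t) = j} = p j n h for
   every t at which the conditioning event is not null (in particular for
   t = 0).  The law of N(0) is arbitrary. *)
Record markov_chain d (Omega : measurableType d) (R : realType)
    (P : probability Omega R) (N : R -> Omega -> int)
    (p : int -> int -> R -> R) : Prop := MarkovChain {
  markov_measurable : forall (t : R) (n : int),
    0 <= t -> measurable (state_at N t n) ;
  markov_property : forall (s : seq (R * int)) (t h : R) (j n : int),
    0 <= t -> 0 <= h -> (forall x, x \in s -> 0 <= x.1 < t) ->
    P (history N s `&` state_at N t j) != 0%E ->
    cond_prob P (state_at N (t + h) n) (history N s `&` state_at N t j)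
      = p j n h }.

Definition transition_rate (R : realType) (p : int -> int -> R -> R)
    (j n : int) (nu : R) : Prop :=
  (fun h : R => h^-1 * p j n h) @ 0^'+ --> nu.

(* Over a time span h, the chain does anything other than stay put or move to
   one of the two neighbours with probability o(h).  This makes all other
   rates vanish, and the total rate of leaving j is the sum of the two rates to
   its neighbours. *)
Definition nearest_neighbour (R : realType) (p : int -> int -> R -> R) : Prop :=
  forall j : int,
    (fun h : R => h^-1 * (1 - (p j (j - 1) h + p j j h + p j (j + 1) h)))
      @ 0^'+ --> (0 : R).

Definition has_sum_from (R : realType) (m : nat) (u : nat -> R) (S : R) : Prop :=
  (fun M : nat => \sum_(m <= n < M) u n) @ \oo --> S.

(* Used for m <= n only, where the truncated subtraction is exact. *)
Definition inner_sum (R : realType) (n m : nat) (rho : R) : R :=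
  \sum_(0 <= k < (n - m).+1)
    'C(n, k)%:R * 'C(n, k + m)%:R * rho ^- (2 * k + m).

(* Main.v *)
(* Conditioning on the position after a short time h gives the backward equation
   p_j' = c_j (p_(j-1) + p_(j+1) - 2 p_j) for every fixed target state, with
   c_j the rate at j; every state has positive probability at some time, so the
   Markov property determines every row of p.  After multiplication by
   e^((lam + mu) t) it becomes w' = B w, where B is bounded for the sup norm, and
   the bounded solution w is the sum of its Taylor series t^k / k! B^k w(0).
   B^2 is translation invariant on each parity class, with symbol
   (lam + mu z) (lam + mu / z); hence B^(2n) w(0) consists of the coefficients of
   the n-th power of this symbol, which are the inner sums of the theorem. *)

Require Import Defs.
From HB Require Import structures.
From mathcomp Require Import all_boot all_order all_algebra.
From mathcomp Require Import all_classical all_reals all_analysis.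
From mathcomp Require Import ring lra zify.

Set Implicit Arguments.
Unset Strict Implicit.
Unset Printing Implicit Defensive.

Import Order.TTheory GRing.Theory Num.Theory.
Import numFieldNormedType.Exports.

Local Open Scope ring_scope.

(** * Coefficients of ((a + b z) (a + b / z)) ^ n *)

(* The coefficient of z^m in (a^2 + b^2 + a b (z + 1/z))^n. *)
Fixpoint walk_coef (R : comNzRingType) (a b : R) (n : nat) (m : int) : R :=
  if n is n'.+1 then
    (a ^+ 2 + b ^+ 2) * walk_coef a b n' m
    + a * b * (walk_coef a b n' (m - 1) + walk_coef a b n' (m + 1))
  else (m == 0)%:R.

Lemma walk_coefC (R : comNzRingType) (a b : R) n m :
  walk_coef a b n m = walk_coef b a n m.
Proof. by elim: n m => //= n IHn m; rewrite !IHn addrC [a * b]mulrC addrC [a ^+ 2 + _]addrC. Qed.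

Lemma walk_coefN (R : comNzRingType) (a b : R) n m :
  walk_coef a b n (- m) = walk_coef a b n m.
Proof.
elim: n m => /= [|n IHn] m; first by rewrite oppr_eq0.
have -> : - m + 1 = - (m - 1) by lia.
by rewrite -opprD !IHn (addrC (walk_coef a b n (m + 1))).
Qed.

(** Each factor widens the support by one on either side. This is why the series of the theorem can
    start at [absz m]. *)
Lemma walk_coef_small (R : comNzRingType) (a b : R) n m :
  (n < absz m)%N -> walk_coef a b n m = 0.
Proof.
elim: n m => /= [|n IHn] m nm.
  by case: eqP => // m0; rewrite m0 in nm.
by rewrite !IHn ?addr0 ?mulr0 ?addr0 //; lia.
Qed.

(* Multiplying ((a + b z) (b / z + a))^n by z^n makes it a polynomial. *)
Lemma walk_coef_poly (R : comNzRingType) (a b : R) n (i : nat) :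
  walk_coef a b n (i%:Z - n%:Z)
  = ((a%:P + b *: 'X) ^+ n * (b%:P + a *: 'X) ^+ n)`_i.
Proof.
elim: n i => [|n IHn] i /=.
  by rewrite !expr0 mulr1 coef1 subr0 eqz_nat.
pose Q' : {poly R} := (a%:P + b *: 'X) ^+ n * (b%:P + a *: 'X) ^+ n.
have -> : (a%:P + b *: 'X) ^+ n.+1 * (b%:P + a *: 'X) ^+ n.+1 =
  (a * b) *: Q' + ((a ^+ 2 + b ^+ 2) *: Q') * 'X + ((a * b) *: Q') * 'X * 'X.
  rewrite /Q' !(exprS _ n) -!mul_polyC !rmorphD /= !rmorphM /=; ring.
have hQ k : Q'`_k = walk_coef a b n (k%:Z - n%:Z) by rewrite IHn.
rewrite !coefD !coefMX !coefZ.
(* For [i = 0] and [i = 1] the shifts by ['X] run out of coefficients; the matching values of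
   [walk_coef] have index below [- n] and vanish. *)
case: i => [|[|i]] /=; rewrite ?hQ.
- rewrite (@walk_coef_small _ _ _ n (0%N%:Z - _)) ?(@walk_coef_small _ _ _ n (_ - 1)); try lia.
  rewrite (_ : (0 - n.+1%:Z + 1) = 0%N%:Z - n%:Z :> int); last lia.
  ring.
- rewrite (@walk_coef_small _ _ _ n (_ - 1)); try lia.
  rewrite (_ : (1 - n.+1%:Z + 1) = 1%N%:Z - n%:Z :> int); last lia.
  rewrite (_ : (1 - n.+1%:Z) = 0%N%:Z - n%:Z :> int); last lia.
  ring.
- rewrite (_ : (i.+2%:Z - n.+1%:Z + 1) = i.+2%:Z - n%:Z :> int); last lia.
  rewrite (_ : (i.+2%:Z - n.+1%:Z - 1) = i%:Z - n%:Z :> int); last lia.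
  rewrite (_ : (i.+2%:Z - n.+1%:Z) = i.+1%:Z - n%:Z :> int); last lia.
  ring.
Qed.

Lemma coef_linear_exp (R : comNzRingType) (a b : R) n i : (i <= n)%N ->
  ((a%:P + b *: 'X) ^+ n)`_i = 'C(n, i)%:R * (a ^+ (n - i) * b ^+ i).
Proof.
move=> le_in; rewrite exprDn coef_sum (bigD1 (inord i)) //= inordK ?ltnS //.
rewrite big1 ?addr0 => [|j ji].
  by rewrite -!polyC_exp exprZn coefMn coefCM coefZ coefXn eqxx mulr1 mulr_natl.
rewrite -!polyC_exp exprZn coefMn coefCM coefZ coefXn.
case: eqP => [e|_]; last by rewrite !mulr0 mul0rn.
by rewrite e inord_val eqxx in ji.
Qed.

Lemma coef_linear_exp_big (R : comNzRingType) (a b : R) n i : (n < i)%N ->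
  ((a%:P + b *: 'X) ^+ n)`_i = 0.
Proof.
move=> ni; rewrite exprDn coef_sum big1 // => j _.
rewrite -!polyC_exp exprZn coefMn coefCM coefZ coefXn.
case: eqP => [e|_]; last by rewrite !mulr0 mul0rn.
by have := ltn_ord j; rewrite -e ltnS leqNgt ni.
Qed.

(** For [m] nonnegative this is the Cauchy product of two binomial expansions at degree [n + m],
    reindexed by [j = k + m]; negative [m] follows by symmetry. *)
Lemma walk_coef_inner_sum (R : realType) (a b : R) n m :
  a != 0 -> b != 0 -> (absz m <= n)%N ->
  walk_coef a b n m = a ^+ (2 * n) * inner_sum n (absz m) (a / b).
Proof.
move=> a0 b0.
wlog: m / 0 <= m => [hw mn|].
  have [m0|m0] := leP 0 m; first exact: hw.
  by rewrite -walk_coefN -abszN hw ?abszN //; lia.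
case: m => // m _; rewrite /= => mn.
have -> : Posz m = (n + m)%N%:Z - n%:Z by lia.
rewrite walk_coef_poly coefM.
rewrite /inner_sum -(big_mkord xpredT (fun j => 
  ((a%:P + b *: 'X) ^+ n)`_j * ((b%:P + a *: 'X) ^+ n)`_(n + m - j))).
(* Only [m <= j <= n] survives: below [m] the second factor is taken beyond its degree, above [n]
   the first one is. *)
rewrite (big_cat_nat (n := m)) //=; last lia.
rewrite big_nat_cond big1 ?add0r; last first.
  by move=> j /andP[/andP[_ jm] _]; rewrite [X in _ * X]coef_linear_exp_big ?mulr0 //; lia.
rewrite (big_cat_nat (n := n.+1)) //=; try lia.
rewrite [X in _ + X]big_nat_cond [X in _ + X]big1 ?addr0; last first.
  by move=> j /andP[/andP[nj _] _]; rewrite coef_linear_exp_big ?mul0r //; lia.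
rewrite -{1}[m]add0n big_addn mulr_sumr subSn //.
apply: eq_big_nat => k /andP[_ kn].
rewrite !coef_linear_exp; try lia.
have -> : (n + m - (k + m) = n - k)%N by lia.
rewrite bin_sub; last lia.
have -> : (n - (n - k) = k)%N by lia.
have -> : (a / b) ^- (2 * k + m) = b ^+ (2 * k + m) / a ^+ (2 * k + m).
  by rewrite expr_div_n invf_div.
have -> : a ^+ (2 * n) = a ^+ (n - (k + m)) * a ^+ (n - k) * a ^+ (2 * k + m).
  by rewrite -!exprD; congr (_ ^+ _); lia.
have -> : b ^+ (2 * k + m) = b ^+ (k + m) * b ^+ k.
  by rewrite -exprD; congr (_ ^+ _); lia.
have := expf_neq0 (2 * k + m) a0.
by set x := a ^+ (2 * k + m) => x0; field.
Qed.

(** * Transition probabilities of the chain *)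

Section MarkovChain.
Local Open Scope classical_set_scope.
Context (R : realType) (d : measure_display) (Omega : measurableType d).
Variables (P : probability Omega R) (N : R -> Omega -> int).
Variables (p : int -> int -> R -> R) (N_markov : markov_chain P N p).

Let Pr (A : set Omega) : R := fine (P A).

Let PrE A : measurable A -> P A = (Pr A)%:E.
Proof. by move=> mA; rewrite fineK // fin_num_measure. Qed.

Let Pr_ge0 A : 0 <= Pr A.
Proof. exact: fine_ge0. Qed.

Let PrDI A B : measurable A -> measurable B -> Pr A = Pr (A `\` B) + Pr (A `&` B).
Proof.
move=> mA mB; apply: EFin_inj; rewrite EFinD -!PrE ?(measureDI P mA mB) //.
- exact: measurableI.
- exact: measurableD.
Qed.

Let Pr_le A B : measurable A -> measurable B -> A `<=` B -> Pr A <= Pr B.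
Proof. by move=> mA mB AB; rewrite -lee_fin -!PrE // le_measure ?inE. Qed.

Let PrU A B : measurable A -> measurable B -> A `&` B = set0 ->
  Pr (A `|` B) = Pr A + Pr B.
Proof.
move=> mA mB AB; apply: EFin_inj; rewrite EFinD -!PrE ?measureU //.
exact: measurableU.
Qed.

Let mS t n : 0 <= t -> measurable (state_at N t n).
Proof. exact: (markov_measurable N_markov). Qed.

Let state_atI t m n : m != n -> state_at N t m `&` state_at N t n = set0.
Proof.
move=> /eqP mn; rewrite -subset0 => w [/= wm wn]; apply: mn.
by rewrite -wm -wn.
Qed.

(* When P B = 0 both sides vanish, so no positivity assumption is needed. *)
Let Pr_cond A B (c : R) : measurable A -> measurable B ->
  (P B != 0%E -> cond_prob P A B = c) -> Pr (A `&` B) = c * Pr B.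
Proof.
move=> mA mB; have [PB0 _|PB0 /(_ isT) <-] := eqVneq (P B) 0%E.
  rewrite {2}/Pr PB0 mulr0; apply/eqP; rewrite eq_le Pr_ge0 andbT.
  rewrite (_ : 0 = Pr B); last by rewrite /Pr PB0.
  by apply: Pr_le => //; exact: measurableI.
rewrite /cond_prob -/(Pr _) -/(Pr _) divfK //.
by apply: contra PB0 => /eqP PB0; rewrite PrE // PB0.
Qed.

(** The Markov property with empty history, multiplied out so that it also covers null events. *)
Lemma Pr_transition t h j n : 0 <= t -> 0 <= h ->
  Pr (state_at N (t + h) n `&` state_at N t j) = p j n h * Pr (state_at N t j).
Proof.
move=> t0 h0; apply: Pr_cond => [||PB]; first by apply: mS; exact: addr_ge0.
  exact: mS.
have hT : history N [::] `&` state_at N t j = state_at N t j.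
  by rewrite setIidr // => w _ x; rewrite in_nil.
by rewrite -{1}hT; apply: (markov_property N_markov) => //; rewrite hT.
Qed.

(** The Markov property at time [t + h] with the single past observation [(t, j)]. The step [h] is
    strictly positive because observations in a history precede the present strictly. *)
Lemma Pr_transition2 t h u j m n : 0 <= t -> 0 < h -> 0 <= u ->
  Pr (state_at N (t + (h + u)) n `&` (state_at N t j `&` state_at N (t + h) m))
  = p m n u * (p j m h * Pr (state_at N t j)).
Proof.
move=> t0 h0 u0; rewrite -(Pr_transition _ _ t0 (ltW h0)).
have th0 : 0 <= t + h by rewrite addr_ge0 // ltW.
rewrite [state_at N (t + h) m `&` _]setIC.
apply: Pr_cond => [||PB]; first by apply: mS; rewrite addrA addr_ge0.
  by apply: measurableI; exact: mS.
have hT : history N [:: (t, j)] = state_at N t j.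
  apply/seteqP; split => w /=; first by move=> /(_ (t, j)); apply; rewrite inE.
  by move=> wj x; rewrite inE => /eqP ->.
rewrite -{1}hT addrA; apply: (markov_property N_markov) => //; last by rewrite hT.
by move=> x; rewrite inE => /eqP -> /=; rewrite t0 ltrDl.
Qed.

(** The chain constrains row [j] of [p] only through conditioning on non-null events, so facts about
    that row are first proved under this condition. *)
Definition reachable (j : int) := exists2 t, 0 <= t & P (state_at N t j) != 0%E.

Let reachable_pos j : reachable j -> exists2 t, 0 <= t & 0 < Pr (state_at N t j).
Proof.
move=> [t t0 Pt]; exists t => //; rewrite lt_def Pr_ge0 andbT.
by apply: contra Pt => /eqP Pt; rewrite PrE ?Pt //; exact: mS.
Qed.

(** Otherwise the whole space would be a countable union of null events at time 0, the integers
    being enumerated by [pickle]. *)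
Lemma reachable_exists : exists j, reachable j.
Proof.
apply: contrapT => nr.
have N0 j : P (state_at N 0 j) = 0%E.
  by apply: contrapT => /eqP Pj; apply: nr; exists j, 0.
have := probability_setT P.
have : P.-negligible (\bigcup_k 
   if unpickle k is Some j then state_at N 0 j else set0).
  apply: negligible_bigcup => k; case: unpickle => [j|]; last exact: negligible_set0.
  by apply/negligibleP => /=; [exact: mS|exact: N0].
rewrite (_ : bigcup _ _ = setT).
  by move/negligibleP => -> // /esym /eqP; rewrite onee_eq0.
by apply/seteqP; split => // w _; exists (pickle (N 0 w)) => //; rewrite pickleK.
Qed.

Lemma transition_ge0 j n h : reachable j -> 0 <= h -> 0 <= p j n h.
Proof.
move=> /reachable_pos [t t0 Pt] h0.
by rewrite -(pmulr_lge0 _ Pt) -Pr_transition.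
Qed.

Lemma transition_le1 j n h : reachable j -> 0 <= h -> p j n h <= 1.
Proof.
move=> /reachable_pos [t t0 Pt] h0.
rewrite -(ler_pM2r Pt) -Pr_transition // mul1r; apply: Pr_le => //.
  by apply: measurableI; apply: mS => //; exact: addr_ge0.
exact: mS.
Qed.

Lemma transition0 j n : reachable j -> p j n 0 = (n == j)%:R.
Proof.
move=> /reachable_pos [t t0 Pt]; apply: (mulIf (lt0r_neq0 Pt)).
rewrite -Pr_transition // addr0; case: eqVneq => [->|nj].
  by rewrite setIid mul1r.
by rewrite state_atI // mul0r /Pr measure0.
Qed.

(** The probability of being in [n] at time [t + h] is at least that of passing through [j] at time
    [t], a product of two positive numbers. *)
Lemma reachable_trans j n h : reachable j -> 0 <= h -> p j n h != 0 ->
  reachable n.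
Proof.
move=> /reachable_pos [t t0 Pt] h0 pn; exists (t + h); first exact: addr_ge0.
apply/eqP => P0.
have : 0 < p j n h * Pr (state_at N t j).
  rewrite lt_def -{2}Pr_transition // Pr_ge0 andbT.
  by rewrite mulf_neq0 // gt_eqF.
rewrite -Pr_transition // ltNge => /negP; apply.
have -> : 0 = Pr (state_at N (t + h) n) by rewrite /Pr P0.
have mn : measurable (state_at N (t + h) n) by apply: mS; exact: addr_ge0.
by apply: Pr_le => //; apply: measurableI => //; exact: mS.
Qed.

(* Conditioning on the three likely positions at time h, instead of on all of
   them, avoids infinite sums; the error is uniform in u. *)
Lemma chapman_kolmogorov_nearest j n h u : reachable j -> 0 < h -> 0 <= u ->
  0 <= p j n (h + u) - (p j (j - 1) h * p (j - 1) n u + p j j h * p j n u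
                        + p j (j + 1) h * p (j + 1) n u)
    <= 1 - (p j (j - 1) h + p j j h + p j (j + 1) h).
Proof.
set s := p j (j - 1) h + _ + _; set v := _ * _ + _ + _.
move=> rj h0 u0; have [t t0 Pt] := reachable_pos rj.
have th0 : 0 <= t + h by rewrite addr_ge0 // ltW.
set B := state_at N t j.
pose E m := state_at N (t + h) m.
pose A := state_at N (t + (h + u)) n.
have mA : measurable A by apply: mS; rewrite addrA addr_ge0.
have mB : measurable B by exact: mS.
have mE m : measurable (E m) by exact: mS.
have mBE m : measurable (B `&` E m) by exact: measurableI.
pose U := (B `&` E (j - 1)) `|` (B `&` E j) `|` (B `&` E (j + 1)).
have mU : measurable U by do 2?[apply: measurableU => //].
have BEI m m' : m != m' -> (B `&` E m) `&` (B `&` E m') = set0.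
  by move=> mm; rewrite setIACA (state_atI (t + h) mm) setI0.
have PrU3 (C : set Omega) : measurable C ->
    Pr (C `&` U) = Pr (C `&` (B `&` E (j - 1))) + Pr (C `&` (B `&` E j))
                   + Pr (C `&` (B `&` E (j + 1))).
  move=> mC; have mCBE m : measurable (C `&` (B `&` E m)) by exact: measurableI.
  have CBEI m m' : m != m' -> (C `&` (B `&` E m)) `&` (C `&` (B `&` E m')) = set0.
    by move=> mm; rewrite setIACA (BEI _ _ mm) setI0.
  rewrite !setIUr PrU //; last by rewrite setIUl !CBEI ?setU0 //; lia.
    by rewrite PrU // CBEI //; lia.
  exact: measurableU.
have PrBU : Pr (B `&` U) = s * Pr B.
  rewrite PrU3 // !(setIA B B) setIid /s !mulrDl.
  by rewrite -!Pr_transition ?(ltW h0) // ![B `&` _]setIC.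
have PrAU : Pr (A `&` U) = v * Pr B.
  rewrite PrU3 // !Pr_transition2 // /v !mulrDl.
  by rewrite ![p _ n u * (_ * _)]mulrA ![p _ n u * _]mulrC.
have PrAB : Pr (A `&` B) = p j n (h + u) * Pr B.
  by rewrite Pr_transition // addr_ge0 // ltW.
have UB : U `<=` B by move=> w [[[]|[]]|[]].
(* Up to the factor [Pr B], the error is the probability of ending in [n] after leaving the three
   positions; it is at most the probability of leaving them at all. *)
have eAB : Pr (A `&` B) = Pr ((A `&` B) `\` U) + Pr (A `&` U).
  rewrite (@PrDI _ U) //; last exact: measurableI.
  by rewrite -setIA (setIidr UB).
have eB : Pr B = Pr (B `\` U) + Pr (B `&` U) by exact: PrDI.
have le : Pr ((A `&` B) `\` U) <= Pr (B `\` U).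
  apply: Pr_le; [apply: measurableD => //; exact: measurableI|exact: measurableD|].
  by move=> w [[_ ?] ?].
have ge := Pr_ge0 ((A `&` B) `\` U).
have e : (p j n (h + u) - v) * Pr B = Pr ((A `&` B) `\` U).
  by rewrite mulrBl -PrAB -PrAU eAB addrK.
apply/andP; split; first by rewrite -(pmulr_lge0 _ Pt) e.
by rewrite -(ler_pM2r Pt) e mulrBl mul1r -PrBU {1}eB addrK.
Qed.

End MarkovChain.

(** * Derivatives from uniform right increments *)

Section RightIncrements.
Local Open Scope classical_set_scope.
Variable R : realType.
Implicit Types f G : R -> R.

(** A right derivative, uniform in the starting time. Conditioning gives only forward increments;
    uniformity is what later recovers the left derivative. *)
Definition right_increment f G := forall e : R, 0 < e ->
  \forall h \near 0^'+, forall t, 0 <= t -> `|f (t + h) - f t - h * G t| <= e * h.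

Definition right_unif_cont f := forall e : R, 0 < e ->
  \forall h \near 0^'+, forall t, 0 <= t -> `|f (t + h) - f t| <= e.

Lemma near_right0P (Q : R -> Prop) : (\forall h \near 0^'+, Q h) ->
  exists2 delta, 0 < delta & forall h, 0 < h < delta -> Q h.
Proof.
case=> delta /= d0 hQ; exists delta => // h /andP[h0 hd]; apply: hQ => //=.
by rewrite sub0r normrN gtr0_norm.
Qed.

Lemma right_increment_unif_cont f G (K : R) : 
  (forall t, 0 <= t -> `|G t| <= K) -> right_increment f G -> right_unif_cont f.
Proof.
move=> GK fG e e0.
have K0 : 0 <= K by apply: le_trans (GK 0 (lexx _)); exact: normr_ge0.
have K1 : 0 < K + 1 by rewrite ltr_wpDl.
near=> h => t t0.
have h0 : 0 < h by near: h; exact: nbhs_right_gt.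
have he : h < e / (K + 1) by near: h; apply: nbhs_right_lt; exact: divr_gt0.
(* With error constant 1 the increment is at most [(K + 1) * h], whatever [t] is. *)
have /(_ t t0) H : forall t, 0 <= t -> `|f (t + h) - f t - h * G t| <= 1 * h.
  by near: h; apply: fG.
have -> : f (t + h) - f t = (f (t + h) - f t - h * G t) + h * G t by ring.
apply: le_trans (ler_normD _ _) _.
rewrite normrM (gtr0_norm h0).
apply: (@le_trans _ _ (h * (K + 1))).
  by rewrite mulrDr mulr1 addrC lerD ?ler_pM2l ?GK //; rewrite mul1r in H.
by rewrite -ler_pdivlMr // ltW.
Unshelve. all: by end_near. Qed.

Lemma right_unif_contD f g : right_unif_cont f -> right_unif_cont g ->
  right_unif_cont (fun t => f t + g t).
Proof.
move=> hf hg e e0; have e2 : 0 < e / 2 by rewrite divr_gt0.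
near=> h => t t0.
have /(_ t t0) Hf : forall t, 0 <= t -> `|f (t + h) - f t| <= e / 2.
  by near: h; apply: hf.
have /(_ t t0) Hg : forall t, 0 <= t -> `|g (t + h) - g t| <= e / 2.
  by near: h; apply: hg.
rewrite opprD addrACA (splitr e).
by apply: le_trans (ler_normD _ _) _; exact: lerD.
Unshelve. all: by end_near. Qed.

Lemma right_unif_contZ (k : R) f : right_unif_cont f ->
  right_unif_cont (fun t => k * f t).
Proof.
move=> hf e e0; have k1 : 0 < `|k| + 1 by rewrite ltr_wpDl.
have ek : 0 < e / (`|k| + 1) by rewrite divr_gt0.
near=> h => t t0.
have /(_ t t0) Hf : forall t, 0 <= t -> `|f (t + h) - f t| <= e / (`|k| + 1).
  by near: h; apply: hf.
rewrite -mulrBr normrM.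
apply: (@le_trans _ _ ((`|k| + 1) * `|f (t + h) - f t|)).
  by rewrite ler_wpM2r // lerDl.
by rewrite mulrC -ler_pdivlMr.
Unshelve. all: by end_near. Qed.

(** For negative [h] the increment estimate is used at [t + h], and uniform continuity replaces
    [G (t + h)] by [G t]; each of the two errors takes half of [e]. *)
Lemma right_increment_is_derive f G (t : R) : right_unif_cont G ->
  right_increment f G -> 0 < t -> is_derive t 1 f (G t).
Proof.
move=> hG hf t0.
have H : (fun h => h^-1 *: (f (h *: 1 + t) - f t)) @ 0^' --> G t.
  apply/cvgrPdist_le => e e0.
  have e2 : 0 < e / 2 by rewrite divr_gt0.
  have [d1 d10 H1] := near_right0P (hf _ e2).
  have [d2 d20 H2] := near_right0P (hG _ e2).
  near=> h.
  have hd1 : `|h| < d1 by near: h; exact: dnbhs0_lt.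
  have hd2 : `|h| < d2 by near: h; exact: dnbhs0_lt.
  (* This keeps [t + h] nonnegative, where the uniform estimates apply. *)
  have ht : `|h| < t by near: h; exact: dnbhs0_lt.
  have h0 : h != 0 by near: h; exact: nbhs_dnbhs_neq.
  have nh0 : 0 < `|h| by rewrite normr_gt0.
  rewrite /= [h *: 1]mulr1 [h + t]addrC.
  rewrite -(ler_pM2r nh0) -normrM.
  have -> : (G t - h^-1 *: (f (t + h) - f t)) * h = - (f (t + h) - f t - h * G t).
    by rewrite /GRing.scale /=; field.
  rewrite normrN.
  (* A backward step from t is a forward step from t + h. *)
  have [hp|hn] := ltP 0 h.
    apply: (@le_trans _ _ (e / 2 * `|h|)).
      by rewrite (gtr0_norm hp) H1 ?(ltW t0) // hp -(gtr0_norm hp).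
    by rewrite ler_pM2r //; lra.
  have hn' : `|h| = - h by rewrite ler0_norm.
  have th0 : 0 <= t + h by lra.
  have A1 : `|f (t + h - h) - f (t + h) - (- h) * G (t + h)| <= e / 2 * (- h).
    by rewrite H1 // -hn' nh0.
  have A2 : `|G (t + h - h) - G (t + h)| <= e / 2.
    by rewrite H2 // -hn' nh0.
  rewrite addrK in A1 A2.
  have -> : f (t + h) - f t - h * G t =
    - (f t - f (t + h) - (- h) * G (t + h)) + (- h) * (G t - G (t + h)) by ring.
  apply: le_trans (ler_normD _ _) _.
  rewrite normrN normrM normrN hn'.
  have A3 : - h * `|G t - G (t + h)| <= - h * (e / 2).
    by apply: ler_wpM2l => //; rewrite -hn'.
  apply: le_trans (lerD A1 A3) _; lra.
by apply: DeriveDef; [apply/cvg_ex; exists (G t)|exact: cvg_lim].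
Unshelve. all: by end_near. Qed.

Lemma right_unif_cont_continuous f G T : right_unif_cont f ->
  (forall t : R, 0 < t -> is_derive t 1 f (G t)) -> 0 <= T ->
  {within `[0, T], continuous f}.
Proof.
move=> cf df; rewrite le_eqVlt => /predU1P[<-|T0].
  by rewrite set_itv1; exact: continuous_subspace1.
have ct t : 0 < t -> {for t, continuous f}.
  move=> /df dt; apply/differentiable_continuous/derivable1_diffP.
  by apply: ex_derive.
apply/continuous_within_itvP => //; split.
- by move=> t; rewrite in_itv /= => /andP[/ct].
- apply/cvgrPdist_le => e /cf; apply: filterS => h /(_ 0 (lexx 0)).
  by rewrite add0r distrC.
- exact/cvg_at_left_filter/ct.
Qed.

(** Both [g - f] and [g + f] have nonnegative derivatives; the mean value theorem, applied to each,
    gives the two signs of the bound. *)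
Lemma derive_dominated (f g f' g' : R -> R) T : 0 <= T ->
  (forall t : R, 0 < t -> is_derive t 1 f (f' t)) ->
  (forall t : R, 0 < t -> is_derive t 1 g (g' t)) ->
  {within `[0, T], continuous f} -> {within `[0, T], continuous g} ->
  (forall t, 0 <= t <= T -> `|f' t| <= g' t) ->
  `|f T - f 0| <= g T - g 0.
Proof.
move=> T0 df dg cf cg fg.
have itv0 t : t \in `]0, T[%R -> 0 < t by rewrite in_itv => /andP[].
have [||c cT e1] := @MVT_segment R (g - f) (fun t => g' t - f' t) 0 T T0.
- by move=> t /itv0 t0; apply: is_deriveB; [exact: dg|exact: df].
- by move=> x; apply: continuousD _; [exact: cg|apply: continuousN; exact: cf].
have [||c' c'T e2] := @MVT_segment R (g + f) (fun t => g' t + f' t) 0 T T0.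
- by move=> t /itv0 t0; apply: is_deriveD; [exact: dg|exact: df].
- by move=> x; apply: continuousD _; [exact: cg|exact: cf].
rewrite !in_itv /= in cT c'T.
move: e1 e2; rewrite !fctE subr0.
have := fg _ cT; have := fg _ c'T; rewrite !ler_norml => /andP[a1 _] /andP[_ a2].
have : 0 <= (g' c - f' c) * T by rewrite mulr_ge0 // subr_ge0.
have : 0 <= (g' c' + f' c') * T by rewrite mulr_ge0 //; lra.
lra.
Qed.

End RightIncrements.

(** * Taylor expansion of bounded solutions *)

Section Taylor.
Local Open Scope classical_set_scope.
Variables (R : realType) (c d : int -> R) (beta : R).
Hypothesis cd_le : forall j, `|d j| + `|c j| *+ 2 <= beta.

(** A tridiagonal operator on two-sided sequences; [cd_le] bounds its sup norm by [beta]. *)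
Definition generator (x : int -> R) (j : int) : R :=
  d j * x j + c j * (x (j - 1) + x (j + 1)).

Definition solution (w : int -> R -> R) : Prop :=
  (forall j (t : R), 0 < t -> is_derive t 1 (w j) (generator (w^~ t) j)) /\
  (forall j (T : R), 0 <= T -> {within `[0, T], continuous (w j)}).

Lemma generator_le x K j : (forall i, `|x i| <= K) -> `|generator x j| <= beta * K.
Proof.
move=> xK; have K0 : 0 <= K by apply: le_trans (xK 0).
apply: (@le_trans _ _ ((`|d j| + `|c j| *+ 2) * K)); last exact: ler_wpM2r.
apply: le_trans (ler_normD _ _) _; rewrite !normrM mulrDl lerD //.
  by rewrite ler_wpM2l.
rewrite mulrnAl -mulrnAr ler_wpM2l //.
by apply: le_trans (ler_normD _ _) _; rewrite mulr2n lerD.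
Qed.

(** Each coordinate of the image combines only three coordinates of [w], so differentiation commutes
    with the operator. This drives the induction on the Taylor order. *)
Lemma solution_generator w : solution w ->
  solution (fun j t => generator (w^~ t) j).
Proof.
move=> [wd wc].
have E j : (fun s => generator (w^~ s) j) =
    d j \*: w j + c j \*: (w (j - 1) + w (j + 1)) by apply/funext.
split=> [j t t0|j T T0]; rewrite E; last first.
  move=> x; apply: continuousD _; apply: continuousZl_tmp; first exact: wc.
  by apply: continuousD _; exact: wc.
have w0 := wd j t t0; have w1 := wd (j - 1) t t0; have w2 := wd (j + 1) t t0.
exact: is_deriveD.
Qed.

Lemma is_derive_monomial k (t : R) :
  is_derive t 1 (fun s : R => s ^+ k.+1 / k.+1`!%:R) (t ^+ k / k`!%:R).
Proof.
have -> : (fun s : R => s ^+ k.+1 / k.+1`!%:R) = (k.+1`!%:R^-1) \*: (id ^+ k.+1 : R -> R).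
  by apply/funext => s; rewrite mulrC exprfctE.
apply: is_derive_eq; rewrite /GRing.scale /= mulr1 factS natrM.
by rewrite invfM mulrACA mulVf ?pnatr_eq0 // mul1r mulrC.
Qed.

(** The derivative of the remainder of order [M.+1] of [w] is the remainder of order [M] of its
    image under [generator]; [derive_dominated] integrates the bound on the latter. *)
Lemma solution_taylor_le (w : int -> R -> R) (K T : R) M j : solution w ->
  (forall i (t : R), 0 <= t <= T -> `|w i t| <= K) -> 0 <= T -> forall t : R, 0 <= t <= T ->
  `|w j t - \sum_(k < M) t ^+ k / k`!%:R * iter k generator (w^~ 0) j|
    <= K * beta ^+ M * (t ^+ M / M`!%:R).
Proof.
elim: M w K j => [|M IHM] w K j sw wK T0 t tT.
  by rewrite big_ord0 subr0 expr0 fact0 divr1 !mulr1 wK.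
have [wd wc] := sw; have /andP[t0 tleT] := tT.
pose v i s := generator (w^~ s) i.
pose f s := w j s - \sum_(k < M.+1) s ^+ k / k`!%:R * iter k generator (w^~ 0) j.
pose g s : R := K * beta ^+ M.+1 * (s ^+ M.+1 / M.+1`!%:R).
pose f' s := v j s - \sum_(k < M) s ^+ k / k`!%:R * iter k generator (v^~ 0) j.
pose g' s : R := K * beta ^+ M.+1 * (s ^+ M / M`!%:R).
have f0 : f 0 = 0.
  rewrite /f big_ord_recl expr0 fact0 divr1 mul1r /= big1 ?addr0 ?subrr // => k _.
  by rewrite /bump /= add1n expr0n mul0r mul0r.
have g0 : g 0 = 0 by rewrite /g expr0n mul0r mulr0.
have dmon (a : R) k (s : R) :
    is_derive s 1 (fun s : R => s ^+ k.+1 / k.+1`!%:R * a) (s ^+ k / k`!%:R * a).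
  have dm := is_derive_monomial k s.
  have -> : (fun s : R => s ^+ k.+1 / k.+1`!%:R * a) =
    a \*: (fun s : R => s ^+ k.+1 / k.+1`!%:R) by apply/funext => u /=; rewrite mulrC.
  by rewrite [X in is_derive _ _ _ X]mulrC; exact: is_deriveZ.
pose q k (s : R) : R := s ^+ k / k`!%:R * iter k generator (w^~ 0) j.
(* The term of order 0 does not depend on [s]; splitting it off leaves monomials of positive degree,
   covered by [dmon]. *)
have fE : f = w j - (cst (q 0%N 0) + \sum_(k < M) q k.+1).
  apply/funext => s; rewrite !fctE /f big_ord_recl; congr (_ - (_ + _)).
  by rewrite fct_sumE; apply: eq_bigr.
have df (s : R) : 0 < s -> is_derive s 1 f (f' s).
  move=> s0; rewrite fE.
  have ws := wd j s s0.
  have qs := @is_derive_sum _ _ _ M (fun k => q k.+1) s 1 _ (fun k => dmon _ k s).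
  apply: is_derive_eq; rewrite add0r /f' /v; congr (_ - _).
  by apply: eq_bigr => k _; rewrite iterSr.
have dg (s : R) : is_derive s 1 g (g' s).
  have -> : g = (fun s : R => s ^+ M.+1 / M.+1`!%:R * (K * beta ^+ M.+1)).
    by apply/funext => u; rewrite /g mulrC.
  by rewrite /g' [X in is_derive _ _ _ X]mulrC; exact: dmon.
have cts (h : R -> R) : (forall s : R, derivable h s 1) -> continuous h.
  by move=> dh s; apply/differentiable_continuous/derivable1_diffP.
have cf : {within `[0, t], continuous f}.
  rewrite fE => x; apply: continuousD _; first exact: wc.
  apply: continuousN; apply: continuous_subspaceT; apply: cts => s.
  have qs := @is_derive_sum _ _ _ M (fun k => q k.+1) s 1 _ (fun k => dmon _ k s).
  by apply: ex_derive.
have cg : {within `[0, t], continuous g}.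
  by apply: continuous_subspaceT; apply: cts => s; apply: ex_derive.
have := derive_dominated t0 df (fun s _ => dg s) cf cg.
rewrite f0 g0 !subr0; apply => s /andP[s0 st].
have sT : 0 <= s <= T by rewrite s0 (le_trans st).
(* Passing from [w] to [v] costs one factor [beta] in the uniform bound. *)
have := IHM v (beta * K) j (solution_generator sw) _ T0 s sT.
rewrite /f' /g' [K * beta ^+ M.+1](_ : _ = beta * K * beta ^+ M); last by rewrite exprS; ring.
by apply => i u uT; apply: generator_le => i'; exact: wK.
Qed.

(** The remainder bound is [K] times a term of the exponential series at [beta * t], hence tends to
    0. *)
Lemma solution_taylor (w : int -> R -> R) (K t : R) j : solution w ->
  (forall i (s : R), 0 <= s <= t -> `|w i s| <= K) -> 0 <= t ->
  (fun M => \sum_(0 <= k < M) t ^+ k / k`!%:R * iter k generator (w^~ 0) j)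
    @ \oo --> w j t.
Proof.
move=> sw wK t0.
have b0 : (fun M => K * exp_coeff (beta * t) M) @ \oo --> (0 : R).
  rewrite -(mulr0 K); apply: cvgMr; exact: cvg_exp_coeff.
apply/cvgrPdist_le => e e0.
move/cvgrPdist_le : b0 => /(_ e e0); apply: filterS => M.
rewrite sub0r normrN big_mkord => H.
apply: le_trans H; apply: le_trans (ler_norm _).
have := solution_taylor_le M j sw wK t0; move/(_ t); rewrite t0 lexx => /(_ isT).
by rewrite /exp_coeff /= exprMn !mulrA.
Qed.

End Taylor.

(** * Identification of the transition probabilities *)

Section HasSum.
Local Open Scope classical_set_scope.
Variable R : realType.
Implicit Types (u v : nat -> R) (S : R).

(** Agreement is required only from [m] on, the range where [inner_sum] represents [walk_coef]. *)
Lemma has_sum_from_trunc m u v S :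
  (forall n, (n < m)%N -> v n = 0) -> (forall n, (m <= n)%N -> u n = v n) ->
  has_sum_from 0 v S -> has_sum_from m u S.
Proof.
move=> v0 uv; rewrite /has_sum_from (_ : (fun M => _) = (fun M => \sum_(m <= n < M) u n)) //.
apply/funext => M; have [Mm|mM] := leqP M m.
  rewrite [RHS]big_geq // big_nat_cond big1 // => n /andP[/andP[_ nM] _].
  by rewrite v0 // (leq_trans nM).
rewrite (big_cat_nat (n := m)) //= 1?ltnW // big_nat_cond big1 ?add0r.
  by apply: eq_big_nat => n /andP[mn _]; rewrite uv.
by move=> n /andP[/andP[_ nm] _]; exact: v0.
Qed.

(** The partial sums of the paired series form a subsequence of those of [u]. *)
Lemma has_sum_from_pair u S : has_sum_from 0 u S ->
  has_sum_from 0 (fun n => u (2 * n)%N + u (2 * n + 1)%N) S.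
Proof.
move=> uS; rewrite /has_sum_from.
have -> : (fun M => \sum_(0 <= n < M) (u (2 * n)%N + u (2 * n + 1)%N)) =
    (fun M => \sum_(0 <= n < M) u n) \o (fun M => 2 * M)%N.
  apply/funext => M /=; elim: M => [|M IHM]; first by rewrite !big_nil.
  rewrite big_nat_recr //= IHM mulnS !big_nat_recr //= addn1 addrA.
  by [].
exact: (cvg_comp _ _ (@cvg_mulnl 2 isT) uS).
Qed.

(** Nonnegativity makes each series converge by comparison with the sum of both. *)
Lemma has_sum_from_splitD u v S : (forall n, 0 <= u n) -> (forall n, 0 <= v n) ->
  has_sum_from 0 (fun n => u n + v n) S ->
  exists S1 S2, [/\ has_sum_from 0 u S1, has_sum_from 0 v S2 & S = S1 + S2].
Proof.
move=> u0 v0 uvS.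
have cuv : cvgn (series (fun n => u n + v n)) by apply/cvg_ex; exists S.
have uv0 n : 0 <= u n + v n by exact: addr_ge0.
have cu : cvgn (series u).
  by apply: series_le_cvg cuv => // n; rewrite lerDl.
have cv : cvgn (series v).
  by apply: series_le_cvg cuv => // n; rewrite lerDr.
exists (limn (series u)), (limn (series v)); split => //.
apply: (@cvg_unique _ _ (series (fun n => u n + v n) @ \oo)) => //.
rewrite (_ : series _ = series u \+ series v); first exact: cvgD.
by apply/funext => M; rewrite /series /= big_split.
Qed.

End HasSum.

(** The diagonal entry is [b - a] on the parity class of [n] and [a - b] on the other. In two steps
    the cross terms between the classes cancel, and [(b - a) ^+ 2 + 2 * a * b = a ^+ 2 + b ^+ 2]
    yields the recursion of [walk_coef]. *)
Lemma iter_generator (R : realType) (s : R) (c : int -> R) (n : int) :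
  (forall j, c j + c (j + 1) = s) ->
  let a := c n in let b := c (n + 1) in
  let x k := iter k (generator c (fun j => s - 2 * c j)) (fun j => (n == j)%:R) in
  forall k m,
  [/\ x (2 * k)%N (n - 2 * m) = walk_coef a b k m,
      x (2 * k)%N (n + 1 - 2 * m) = 0,
      x (2 * k + 1)%N (n - 2 * m) = (b - a) * walk_coef a b k m &
      x (2 * k + 1)%N (n + 1 - 2 * m)
        = b * (walk_coef a b k m + walk_coef a b k (m - 1))].
Proof.
move=> c_sum a b x.
(* Constant sums of neighbouring rates force period 2. *)
have c2 j : c (j + 2) = c j.
  have := c_sum j; have := c_sum (j + 1).
  by rewrite -addrA => <- /eqP; rewrite [c j + _]addrC (inj_eq (addrI _)) => /eqP ->.
have c2m j m : c (j - 2 * m) = c j.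
  have c2n i (k : nat) : c (i + 2 * k%:Z) = c i.
    elim: k => [|k IHk]; first by rewrite mulr0 addr0.
    by rewrite (_ : i + _ = i + 2 * k%:Z + 2) ?c2 ?IHk //; lia.
  have [m0|m0] := leP m 0.
    by rewrite -[RHS](c2n _ (absz m)); congr (c _); lia.
  by rewrite -(c2n _ (absz m)); congr (c _); lia.
have sE : s = a + b by rewrite c_sum.
have xS k j : x k.+1 j = (s - 2 * c j) * x k j + c j * (x k (j - 1) + x k (j + 1)).
  by [].
have even_step k j : x k.+1 (n - 2 * j) = (b - a) * x k (n - 2 * j)
    + a * (x k (n + 1 - 2 * (j + 1)) + x k (n + 1 - 2 * j)).
  rewrite xS c2m -/a sE; congr (_ * _ + _ * (x _ _ + x _ _)); [ring|lia|lia].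
have odd_step k j : x k.+1 (n + 1 - 2 * j) = (a - b) * x k (n + 1 - 2 * j)
    + b * (x k (n - 2 * j) + x k (n - 2 * (j - 1))).
  rewrite xS c2m -/b sE; congr (_ * _ + _ * (x _ _ + x _ _)); [ring|lia|lia].
have evenP k : (forall m, x (2 * k)%N (n - 2 * m) = walk_coef a b k m) /\
               (forall m, x (2 * k)%N (n + 1 - 2 * m) = 0) ->
    (forall m, x (2 * k + 1)%N (n - 2 * m) = (b - a) * walk_coef a b k m) /\
    (forall m, x (2 * k + 1)%N (n + 1 - 2 * m)
        = b * (walk_coef a b k m + walk_coef a b k (m - 1))).
  move=> [e o]; rewrite addn1; split=> m.
    by rewrite even_step e !o addr0 mulr0 addr0.
  by rewrite odd_step !e o mulr0 add0r.
have even k : (forall m, x (2 * k)%N (n - 2 * m) = walk_coef a b k m) /\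
              (forall m, x (2 * k)%N (n + 1 - 2 * m) = 0).
  elim: k => [|k IHk].
    split=> m; rewrite /x muln0 /=; last by case: eqP => //; lia.
    by congr (_%:R); apply/eqP/eqP; lia.
  have [e o] := evenP _ IHk.
  have -> : (2 * k.+1 = (2 * k + 1).+1)%N by rewrite mulnS addn1.
  split=> m; last by rewrite odd_step o !e; ring.
  by rewrite even_step e !o /= (_ : m + 1 - 1 = m); [ring|lia].
move=> k m; have [e o] := even k; have [e' o'] := evenP _ (even k).
by split.
Qed.

Lemma walk_coef_ge0 (R : realType) (a b : R) n m : 0 <= a -> 0 <= b ->
  0 <= walk_coef a b n m.
Proof.
move=> a0 b0; elim: n m => [|n IHn] m /=; first exact: ler0n.
by rewrite addr_ge0 ?mulr_ge0 ?addr_ge0 ?exprn_ge0.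
Qed.

(** * The backward equation and the series for the transition probabilities *)

Section BirthDeath.
Local Open Scope classical_set_scope.
Context (R : realType) (d : measure_display) (Omega : measurableType d).
Variables (P : probability Omega R) (N : R -> Omega -> int).
Variables (p : int -> int -> R -> R) (N_markov : markov_chain P N p).
Variables (c : int -> R) (s : R).
Hypotheses (c_gt0 : forall j, 0 < c j) (c_sum : forall j, c j + c (j + 1) = s).
Hypothesis rate_up : forall j, transition_rate p j (j + 1) (c j).
Hypothesis rate_down : forall j, transition_rate p j (j - 1) (c j).
Hypothesis p_nearest : nearest_neighbour p.

(** If [p j n h] vanished at a small [h], the difference quotient there would be 0, at distance
    [c j] from its limit. *)
Lemma reachable_rate j n : transition_rate p j n (c j) ->
  reachable P N j -> reachable P N n.
Proof.
move=> /cvgrPdist_lt /(_ _ (c_gt0 j)) jn rj.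
have [delta d0 dP] := near_right0P jn.
have hd : 0 < delta / 2 < delta by lra.
apply: (reachable_trans (h := delta / 2) N_markov rj); first by lra.
apply/eqP => p0; have := dP _ hd.
by rewrite p0 mulr0 subr0 gtr0_norm // ltxx.
Qed.

Lemma reachable_all j : reachable P N j.
Proof.
have [j0 rj0] := reachable_exists N_markov.
have up (k : nat) : reachable P N (j0 + k%:Z).
  elim: k => [|k IHk]; first by rewrite addr0.
  have := reachable_rate (@rate_up _) IHk.
  by rewrite (_ : j0 + k.+1%:Z = j0 + k%:Z + 1) //; lia.
have down (k : nat) : reachable P N (j0 - k%:Z).
  elim: k => [|k IHk]; first by rewrite subr0.
  have := reachable_rate (@rate_down _) IHk.
  by rewrite (_ : j0 - k.+1%:Z = j0 - k%:Z - 1) //; lia.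
have [le_j|lt_j] := leP j0 j.
  by rewrite (_ : j = j0 + (absz (j - j0))%:Z) //; lia.
by rewrite (_ : j = j0 - (absz (j - j0))%:Z) //; lia.
Qed.

Lemma transition_norm_le1 j n t : 0 <= t -> `|p j n t| <= 1.
Proof.
move=> t0; rewrite ger0_norm ?(transition_le1 N_markov) //.
  exact: reachable_all.
by apply: (transition_ge0 N_markov) => //; exact: reachable_all.
Qed.

Let backward j n t := c j * (p (j - 1) n t + p (j + 1) n t - 2 * p j n t).

(** The short step [h] comes first and the long time [t] second. The two rates and the escape
    probability contribute an error [e / 3 * h] each, uniformly in [t] because the entries of [p]
    lie in the unit interval. *)
Lemma backward_increment j n : right_increment (p j n) (backward j n).
Proof.
move=> e e0.
have e3 : 0 < e / 3 by lra.
near=> h => t t0.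
have h0 : 0 < h by near: h; exact: nbhs_right_gt.
have scale (x y : R) : `|x - h^-1 * y| <= e / 3 -> `|y - x * h| <= e / 3 * h.
  rewrite -(ler_pM2r h0) -{2}(gtr0_norm h0) -normrM => le_e.
  by rewrite distrC (_ : x * h - y = (x - h^-1 * y) * h) //; field; rewrite gt_eqF.
have /scale up : `|c j - h^-1 * p j (j + 1) h| <= e / 3.
  near: h; have /cvgrPdist_le := @rate_up j; exact.
have /scale down : `|c j - h^-1 * p j (j - 1) h| <= e / 3.
  near: h; have /cvgrPdist_le := @rate_down j; exact.
have /scale stay : `|0 - h^-1 * (1 - (p j (j - 1) h + p j j h + p j (j + 1) h))| <= e / 3.
  near: h; have /cvgrPdist_le := @p_nearest j; exact.
have := chapman_kolmogorov_nearest N_markov n (reachable_all j) h0 t0.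
have p_ge0 i : 0 <= p i n t by apply: (transition_ge0 N_markov) => //; exact: reachable_all.
have p_le1 i : p i n t <= 1 by apply: (transition_le1 N_markov) => //; exact: reachable_all.
move: up down stay; rewrite [t + h]addrC /backward mul0r subr0.
have := p_ge0 (j - 1); have := p_ge0 j; have := p_ge0 (j + 1).
have := p_le1 (j - 1); have := p_le1 j; have := p_le1 (j + 1).
move: (p (j - 1) n t) (p j n t) (p (j + 1) n t) (p j n (h + t)) => x y z w.
move: (p j (j - 1) h) (p j j h) (p j (j + 1) h) => a0 a1 a2.
move=> z1 y1 x1 z0 y0 x0 up down stay /andP[w0 w1].
set eps := 1 - _ in stay w1.
(* The probability [a1] of staying put is eliminated through [eps], the probability of being outside
   the three positions. *)
have -> : w - y - h * (c j * (x + z - 2 * y)) =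
  (a0 - c j * h) * (x - y) + (a2 - c j * h) * (z - y)
  + (w - (a0 * x + a1 * y + a2 * z) - eps * y) by rewrite /eps; ring.
have eps0 : 0 <= eps by exact: le_trans w1.
have B1 : `|(a0 - c j * h) * (x - y)| <= e / 3 * h.
  by rewrite normrM -[leRHS]mulr1 ler_pM // ler_norml; lra.
have B2 : `|(a2 - c j * h) * (z - y)| <= e / 3 * h.
  by rewrite normrM -[leRHS]mulr1 ler_pM // ler_norml; lra.
(* A difference of two numbers that both lie between 0 and [eps]. *)
have B3 : `|w - (a0 * x + a1 * y + a2 * z) - eps * y| <= e / 3 * h.
  have epsy0 : 0 <= eps * y by exact: mulr_ge0.
  have epsy1 : eps * y <= eps by rewrite ler_piMr.
  by apply: le_trans stay; rewrite [leRHS]ger0_norm // ler_norml; lra.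
apply: le_trans (ler_normD _ _) _; apply: le_trans (lerD (ler_normD _ _) (lexx _)) _.
by apply: le_trans (lerD (lerD B1 B2) B3) _; lra.
Unshelve. all: by end_near. Qed.

Lemma transition_right_unif_cont j n : right_unif_cont (p j n).
Proof.
apply: (right_increment_unif_cont (K := c j * 4) _ (@backward_increment j n)) => t t0.
rewrite /backward normrM gtr0_norm // ler_pM2l //.
have := transition_norm_le1 (j - 1) n t0.
have := transition_norm_le1 (j + 1) n t0.
have := transition_norm_le1 j n t0.
by rewrite !ler_norml; lra.
Qed.

Lemma backward_equation j n (t : R) : 0 < t ->
  is_derive t 1 (p j n) (backward j n t).
Proof.
apply: right_increment_is_derive; last exact: backward_increment.
apply: right_unif_contZ; apply: right_unif_contD; last first.
  under eq_fun do rewrite -mulNr.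
  by apply: right_unif_contZ; exact: transition_right_unif_cont.
by apply: right_unif_contD; exact: transition_right_unif_cont.
Qed.

(* The factor e^(st) turns the diagonal coefficient -2 (c j) of the backward
   equation into s - 2 (c j) = c (j + 1) - c j, which makes the even powers of
   the generator preserve parity. *)
Let scaled n (j : int) (t : R) := expR (s * t) * p j n t.

Lemma scaled_solution n : solution c (fun j => s - 2 * c j) (scaled n).
Proof.
have dexp (t : R) : is_derive t 1 (fun u : R => expR (s * u)) (s * expR (s * t)).
  have -> : (fun u : R => expR (s * u)) = expR \o (s \*: id) by [].
  by apply: is_derive_eq; rewrite /GRing.scale /= mulr1 mulrC.
have E j : scaled n j = (fun u : R => expR (s * u)) * p j n by [].
split=> [j t t0|j T T0]; rewrite E.
  have dexp_t := dexp t; have pt := @backward_equation j n t t0.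
  apply: is_derive_eq.
  rewrite /GRing.scale /= /generator /scaled /backward; ring.
move=> x; apply: continuousM _; last first.
  apply: (right_unif_cont_continuous (G := backward j n)) => //.
    exact: transition_right_unif_cont.
  exact: backward_equation.
apply: continuous_subspaceT => t.
by apply/differentiable_continuous/derivable1_diffP; apply: ex_derive.
Qed.

Lemma transition_series j n t : 0 <= t ->
  has_sum_from 0 (fun k => t ^+ k / k`!%:R * iter k
    (generator c (fun i => s - 2 * c i)) (fun i => (n == i)%:R) j)
    (expR (s * t) * p j n t).
Proof.
move=> t0; have s_ge : 0 < s by rewrite -(c_sum 0) addr_gt0.
have c_le i : c i <= s by rewrite -(c_sum i) lerDl ltW.
(* The norm bound is [s] for the diagonal plus [2 * s] for the two neighbours; [expR (s * t)] bounds
   [scaled n] on the whole time interval, since probabilities are at most 1. *)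
have := @solution_taylor R c (fun i => s - 2 * c i) (s * 3) _ (scaled n) (expR (s * t)) t j
  (scaled_solution n) _ t0.
have -> : (scaled n)^~ 0 = (fun i => (n == i)%:R).
  apply/funext => i; rewrite /scaled mulr0 expR0 mul1r (transition0 N_markov) //.
  exact: reachable_all.
apply=> [i|i u /andP[u0 ut]].
  rewrite (gtr0_norm (c_gt0 i)).
  have : `|s - 2 * c i| <= s.
    by rewrite ler_norml; have := c_gt0 i; have := c_le i; lra.
  by have := c_le i; lra.
rewrite /scaled normrM ger0_norm ?expR_ge0 // -[leRHS]mulr1 ler_pM ?expR_ge0 //.
  by rewrite ler_expR ler_pM2l.
exact: transition_norm_le1.
Qed.

Lemma transition_same_parity n m (t : R) : 0 <= t ->
  let a := c n in let b := c (n + 1) in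
  exists S, has_sum_from (absz m) (fun k =>
      ((a * t) ^+ (2 * k) / ((2 * k)`!)%:R
       + (b - a) / a * ((a * t) ^+ (2 * k + 1) / ((2 * k + 1)`!)%:R))
      * inner_sum k (absz m) (a / b)) S
    /\ p (n - 2 * m) n t = expR (- s * t) * S.
Proof.
move=> t0 a b; exists (expR (s * t) * p (n - 2 * m) n t); split; last first.
  by rewrite mulrA -expRD mulNr addNr expR0 mul1r.
have a0 : a != 0 by exact: lt0r_neq0 (c_gt0 _).
have b0 : b != 0 by exact: lt0r_neq0 (c_gt0 _).
have := has_sum_from_pair (@transition_series (n - 2 * m) n t t0).
apply: has_sum_from_trunc => k km; have [-> _ -> _] := iter_generator n c_sum k m.
  by rewrite walk_coef_small // !mulr0 addr0.
(* The factor [a ^+ (2 * k)] completes the even power of [a * t]; the odd power needs one more [a],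
   whence the division in [(b - a) / a]. *)
rewrite (walk_coef_inner_sum a0 b0 km) -/a -/b !exprMn (addn1 (2 * k)) [a ^+ _.+1]exprSr.
set x := (2 * k)`!%:R^-1; set y := (2 * k).+1`!%:R^-1; field.
exact: a0.
Qed.

(** Only odd iterates contribute. Expanding the symmetric [walk_coef] in [b / a] lets the extra
    factor [b] complete the power [(b * t) ^+ (2 * k + 1)]. *)
Lemma transition_other_parity n m (t : R) : 0 <= t ->
  let a := c n in let b := c (n + 1) in
  exists S1 S2, [/\ has_sum_from (absz (m - 1)) (fun k =>
      (b * t) ^+ (2 * k + 1) / ((2 * k + 1)`!)%:R
      * inner_sum k (absz (m - 1)) (b / a)) S1,
    has_sum_from (absz m) (fun k =>
      (b * t) ^+ (2 * k + 1) / ((2 * k + 1)`!)%:R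
      * inner_sum k (absz m) (b / a)) S2 &
    p (n + 1 - 2 * m) n t = expR (- s * t) * (S1 + S2)].
Proof.
move=> t0 a b.
have a0 : a != 0 by exact: lt0r_neq0 (c_gt0 _).
have b0 : b != 0 by exact: lt0r_neq0 (c_gt0 _).
pose u i k := t ^+ (2 * k + 1) / ((2 * k + 1)`!)%:R * (b * walk_coef b a k i).
have u_ge0 i k : 0 <= u i k.
  apply: mulr_ge0; first by rewrite divr_ge0 ?exprn_ge0.
  by apply: mulr_ge0; [|apply: walk_coef_ge0]; exact: ltW (c_gt0 _).
have total : has_sum_from 0 (fun k => u (m - 1) k + u m k)
    (expR (s * t) * p (n + 1 - 2 * m) n t).
  have := has_sum_from_pair (@transition_series (n + 1 - 2 * m) n t t0).
  apply: has_sum_from_trunc => // k _; have [_ -> _ ->] := iter_generator n c_sum k m.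
  by rewrite mulr0 add0r /u !(walk_coefC b) -/a -/b; ring.
have [S1 [S2 [S1E S2E SE]]] := has_sum_from_splitD (u_ge0 (m - 1)) (u_ge0 m) total.
have trunc i S : has_sum_from 0 (u i) S -> has_sum_from (absz i) (fun k =>
      (b * t) ^+ (2 * k + 1) / ((2 * k + 1)`!)%:R
      * inner_sum k (absz i) (b / a)) S.
  apply: has_sum_from_trunc => k ki; rewrite /u.
    by rewrite walk_coef_small // !mulr0.
  by rewrite (walk_coef_inner_sum b0 a0 ki) exprMn (addn1 (2 * k)) [b ^+ _.+1]exprSr; ring.
exists S1, S2; split; [exact: trunc|exact: trunc|].
by rewrite -SE mulrA -expRD mulNr addNr expR0 mul1r.
Qed.

End BirthDeath.

(** * The four formulas, by parity of the initial and final states *)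

Definition parity_rate (R : realType) (lam mu : R) (j : int) : R :=
  if (2 %| j)%Z then lam else mu.

Theorem proposition1 (R : realType) (d : measure_display)
    (Omega : measurableType d) (P : probability Omega R)
    (N : R -> Omega -> int) (p : int -> int -> R -> R) (lam mu : R)
    (lam_gt0 : 0 < lam) (mu_gt0 : 0 < mu)
    (N_markov : markov_chain P N p)
    (N_nearest : nearest_neighbour p)
    (N_rates : forall n : int,
      [/\ transition_rate p (2 * n) (2 * n + 1) lam,
          transition_rate p (2 * n) (2 * n - 1) lam,
          transition_rate p (2 * n + 1) (2 * n) mu &
          transition_rate p (2 * n - 1) (2 * n) mu])
    (l r : int) (t : R) (t_ge0 : 0 <= t) :
  [/\ exists S : R,
        has_sum_from (absz (r - l)%R) (fun n : nat =>
          ((lam * t) ^+ (2 * n) / ((2 * n)`!)%:R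
           + (mu - lam) / lam
             * ((lam * t) ^+ (2 * n + 1) / ((2 * n + 1)`!)%:R))
          * inner_sum n (absz (r - l)%R) (lam / mu)) S
        /\ p (2 * l) (2 * r) t = expR (- (lam + mu) * t) * S,
      exists S1 S2 : R,
        [/\ has_sum_from (absz (r - l)%R) (fun n : nat =>
              (lam * t) ^+ (2 * n + 1) / ((2 * n + 1)`!)%:R
              * inner_sum n (absz (r - l)%R) (lam / mu)) S1,
            has_sum_from (absz (r - l + 1)%R) (fun n : nat =>
              (lam * t) ^+ (2 * n + 1) / ((2 * n + 1)`!)%:R
              * inner_sum n (absz (r - l + 1)%R) (lam / mu)) S2
          & p (2 * l) (2 * r + 1) t = expR (- (lam + mu) * t) * (S1 + S2)],
      exists S1 S2 : R,
        [/\ has_sum_from (absz (r - l - 1)%R) (fun n : nat =>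
              (mu * t) ^+ (2 * n + 1) / ((2 * n + 1)`!)%:R
              * inner_sum n (absz (r - l - 1)%R) (mu / lam)) S1,
            has_sum_from (absz (r - l)%R) (fun n : nat =>
              (mu * t) ^+ (2 * n + 1) / ((2 * n + 1)`!)%:R
              * inner_sum n (absz (r - l)%R) (mu / lam)) S2
          & p (2 * l + 1) (2 * r) t = expR (- (lam + mu) * t) * (S1 + S2)]
    & exists S : R,
        has_sum_from (absz (r - l)%R) (fun n : nat =>
          ((mu * t) ^+ (2 * n) / ((2 * n)`!)%:R
           + (lam - mu) / mu
             * ((mu * t) ^+ (2 * n + 1) / ((2 * n + 1)`!)%:R))
          * inner_sum n (absz (r - l)%R) (mu / lam)) S
        /\ p (2 * l + 1) (2 * r + 1) t = expR (- (lam + mu) * t) * S].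
Proof.
pose c := parity_rate lam mu.
have c_even (j : int) : c (2 * j) = lam by rewrite /c /parity_rate dvdz_mulr.
have c_odd (j : int) : c (2 * j + 1) = mu.
  by rewrite /c /parity_rate; case: ifP => //; lia.
have parity (j : int) : (exists i : int, j = 2 * i) \/ (exists i : int, j = 2 * i + 1).
  have := divz_eq j 2; have := modz_ge0 j (isT : 2 != 0 :> int).
  have := ltz_pmod j (isT : 0 < 2 :> int) => lt2 ge0 e.
  have [m0|m1] : (j %% 2)%Z = 0 \/ (j %% 2)%Z = 1 by lia.
    by left; exists (j %/ 2)%Z; lia.
  by right; exists (j %/ 2)%Z; lia.
have c_gt0 j : 0 < c j by case: (parity j) => -[i ->]; rewrite ?c_even ?c_odd.
have c_sum j : c j + c (j + 1) = lam + mu.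
  case: (parity j) => -[i ->]; first by rewrite c_even c_odd.
  by rewrite c_odd (_ : 2 * i + 1 + 1 = 2 * (i + 1)) ?c_even 1?addrC //; lia.
have up j : transition_rate p j (j + 1) (c j).
  case: (parity j) => -[i ->]; rewrite ?c_even ?c_odd; first by case: (N_rates i).
  (* The upward rate out of [2 * i + 1] is listed at the even state above it. *)
  have [_ _ _] := N_rates (i + 1).
  have -> : 2 * (i + 1) - 1 = 2 * i + 1 by lia.
  by have -> : 2 * (i + 1) = 2 * i + 1 + 1 by lia.
have down j : transition_rate p j (j - 1) (c j).
  case: (parity j) => -[i ->]; rewrite ?c_even ?c_odd; first by case: (N_rates i).
  by case: (N_rates i) => _ _; rewrite addrK.
have same n m := transition_same_parity N_markov c_gt0 c_sum up down N_nearest n m t_ge0.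
have other n m := transition_other_parity N_markov c_gt0 c_sum up down N_nearest n m t_ge0.
have c_odd1 (j : int) : c (2 * j + 1 + 1) = lam.
  by rewrite (_ : 2 * j + 1 + 1 = 2 * (j + 1)) ?c_even //; lia.
(* In each case [n] is the target state, and [m] is chosen so that [n - 2 * m] or [n + 1 - 2 * m] is
   the initial state. *)
split.
- have := same (2 * r) (r - l); rewrite /= c_even c_odd.
  by rewrite (_ : 2 * r - 2 * (r - l) = 2 * l) //; lia.
- have := other (2 * r + 1) (r - l + 1); rewrite /= c_odd1 c_odd addrK.
  by rewrite (_ : 2 * r + 1 + 1 - 2 * (r - l + 1) = 2 * l) //; lia.
- have := other (2 * r) (r - l); rewrite /= c_even c_odd.
  by rewrite (_ : 2 * r + 1 - 2 * (r - l) = 2 * l + 1) //; lia.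
- have := same (2 * r + 1) (r - l); rewrite /= c_odd1 c_odd.
  by rewrite (_ : 2 * r + 1 - 2 * (r - l) = 2 * l + 1) //; lia.
Qed.
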